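(* Let $\operatorname{Spec}(A)$ be an affine $\mathbb{G}_a$-variety over $k$ with action $\beta$ and let $z_1,\dots,z_n$ generate $A$ as a $k$-algebra. Let $(g,h)$ be a principle pair with $h\ne 0$, let $v_i(Z,t)=\beta^\sharp(z_i)$, and let $f_i(Z)=v_i(Z,-g/h)$ for $1\le i\le n$. Then $$k[f_1(Z),\dots,f_n(Z)]_h=(A_h)^{\mathbb{G}_a}.$$ Moreover, if $r(Z)$ is an element of $(A_h)^{\mathbb{G}_a}$, then it is equal to $r(f_1(Z),\dots,f_n(Z))$.
   Context: $k$ is an algebraically closed field (of any characteristic) and $\mathbb{G}_a=\operatorname{Spec}(k[t])$. Varieties are integral separated schemes of finite type over $k$. The co-action is $\beta^\sharp:A\to A[t]$; $v_i(Z,t)\in A[t]$ denotes $\beta^\sharp(z_i)$ written in terms of $Z=(z_1,\dots,z_n)$ and $t$, and $v_i(Z,-g/h)\in A_h$ is obtained by substituting $t=-g/h$. A principle pair is a pair $(g,h)$ with $g\in A$, $h\in A^{\mathbb{G}_a}$ and $\beta^\sharp(g)=g+t\,h$. An element of $A_h$ is written $r(Z)$, a polynomial expression in $z_1,\dots,z_n$ divided by a power of $h=h(Z)$; $r(f_1(Z),\dots,f_n(Z))$ is obtained by substituting $f_i(Z)$ for $z_i$. *)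

(* Defs.v *)
From HB Require Import structures.
From mathcomp Require Import all_boot all_order all_algebra.
From mathcomp Require Export mpoly.

Set Implicit Arguments.
Unset Strict Implicit.
Unset Printing Implicit Defensive.

Import GRing.Theory.
Local Open Scope ring_scope.

(* A comUnitAlgType that is a domain. The coordinate ring of an affine variety
   over k is an idomAlgType k that is finitely generated as a k-algebra. *)
#[short(type="idomAlgType")]
HB.structure Definition IdomAlgebra (R : nzRingType) :=
  {A of GRing.ComUnitAlgebra R A & GRing.IntegralDomain A}.

Section GaVariety.
Variables (k : fieldType) (A : idomAlgType k).

Definition in_k_alg : k -> A := fun c => c%:A.

Definition alg_generators (n : nat) (z : 'I_n -> A) : Prop :=
  forall a : A, exists P : {mpoly k[n]}, a = mmap in_k_alg z P.

(* The three axioms: k-linearity, the identity element of G_a acts trivially,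
   and (beta (x) id) o beta = (id (x) Delta) o beta with Delta t = s + t.
   The last one lives in {poly {poly A}} = A[s][t]: the outer variable 'X is t
   and the inner one 'X%:P is s. *)
Record Ga_coaction (beta : {rmorphism A -> {poly A}}) : Prop := GaCoaction {
  coaction_scalar : forall c : k, beta c%:A = (c%:A)%:P;
  coaction_counit : forall a : A, (beta a).[0] = a;
  coaction_coassoc : forall a : A,
    map_poly beta (beta a) = map_poly polyC (beta a) \Po ('X%:P + 'X)
}.

Definition Ga_invariant (beta : A -> {poly A}) (a : A) : Prop :=
  beta a = a%:P.

Definition principle_pair (beta : A -> {poly A}) (g h : A) : Prop :=
  Ga_invariant beta h /\ beta g = g%:P + h *: 'X.

Local Notation K := {fraction A}.
Local Notation loc := (@tofrac A).

(* A being a domain, the localization A_h (h != 0) is taken inside {fraction A},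
   as the set of the fractions a / h ^+ m. The relation below is the graph of
   the co-action A_h -> A_h[t], a / h ^+ m |-> beta a / h ^+ m, for h invariant;
   in particular its first argument ranges over A_h only. *)
Definition loc_coaction (beta : A -> {poly A}) (h : A)
    (x : K) (p : {poly K}) : Prop :=
  exists (a : A) (m : nat),
    x = loc a / loc h ^+ m /\ p = (loc h ^+ m)^-1 *: map_poly loc (beta a).

Lemma loc_coaction_functional (beta : {rmorphism A -> {poly A}}) (h : A) x p q :
  h != 0 -> Ga_invariant beta h ->
  loc_coaction beta h x p -> loc_coaction beta h x q -> p = q.
Proof.
move=> h0 inv_h [a [m [-> ->]]] [b [l [eq_ab ->]]].
have u0 j : loc h ^+ j != 0 by rewrite expf_neq0 // tofrac_eq0.
have {}eq_ab : a * h ^+ l = b * h ^+ m.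
  apply/eqP; rewrite -tofrac_eq !tofracM !tofracXn; apply/eqP.
  by move/eqP: eq_ab; rewrite eqr_div // => /eqP.
have eq_beta : h ^+ l *: beta a = h ^+ m *: beta b.
  have := congr1 beta eq_ab; rewrite !rmorphM !rmorphXn inv_h.
  by rewrite -!polyC_exp ![_ * (_ ^+ _)%:P]mulrC !mul_polyC.
have {}eq_beta : loc h ^+ l *: map_poly loc (beta a) =
                 loc h ^+ m *: map_poly loc (beta b).
  by rewrite -!tofracXn -!map_polyZ eq_beta.
apply: (@scalerI _ _ (loc h ^+ l * loc h ^+ m)); first by rewrite mulf_neq0.
rewrite !scalerA mulfK // eq_beta; congr (_ *: _).
by rewrite mulrAC mulfV // mul1r.
Qed.

(* (A_h)^{G_a} *)
Definition loc_Ga_invariant (beta : A -> {poly A}) (h : A) (x : K) : Prop :=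
  loc_coaction beta h x x%:P.

(* P(f_1, ..., f_n) for elements f_i of A_h *)
Definition frac_eval (n : nat) (f : 'I_n -> K) (P : {mpoly k[n]}) : K :=
  mmap (fun c : k => loc (in_k_alg c)) f P.

(* k[f_1, ..., f_n]_h *)
Definition loc_subalg (n : nat) (f : 'I_n -> K) (h : A) (x : K) : Prop :=
  exists (P : {mpoly k[n]}) (m : nat), x = frac_eval f P / loc h ^+ m.

(* v(-g/h), for v in A[t] *)
Definition subst_slice (g h : A) (v : {poly A}) : K :=
  (map_poly loc v).[- (loc g / loc h)].

End GaVariety.

(* Main.v *)
(* Write s = g/h. Substituting t = -s in the co-action gives a ring morphism
   pi : A -> A_h that fixes the invariants and sends z_i to f_i, so every
   invariant fraction r(Z) equals r(f_1, ..., f_n). Conversely the co-action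
   maps pi a to (beta a)(t + t') at t' = -s - t, by co-associativity and
   because beta s = s + t; the variable t cancels, so pi a is invariant. *)
Require Import Defs.
From HB Require Import structures.
From mathcomp Require Import all_boot all_order all_algebra.

Set Implicit Arguments.
Unset Strict Implicit.
Unset Printing Implicit Defensive.

Import GRing.Theory.
Local Open Scope ring_scope.

Lemma rmorph_mmap (n : nat) (R : nzRingType) (S T : comNzRingType)
    (phi : {rmorphism S -> T}) (c : R -> S) (d : R -> T) (z : 'I_n -> S)
    (P : {mpoly R[n]}) :
  (forall u, phi (c u) = d u) ->
  phi (mmap c z P) = mmap d (fun i => phi (z i)) P.
Proof.
move=> phi_c; rewrite /mmap rmorph_sum; apply: eq_bigr => m _.
rewrite rmorphM phi_c; congr (_ * _).
by rewrite /mmap1 rmorph_prod; apply: eq_bigr => i _; rewrite rmorphXn.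
Qed.

Lemma tofrac_inj (R : idomainType) : injective (@tofrac R).
Proof. by move=> a b /eqP; rewrite tofrac_eq => /eqP. Qed.

Section Slice.
Variables (k : fieldType) (A : idomAlgType k) (beta : {rmorphism A -> {poly A}}).
Variables (g h : A).
Hypotheses (betaP : Ga_coaction beta) (gh_pair : principle_pair beta g h).
Hypothesis h_neq0 : h != 0.

Local Notation loc := (@tofrac A).
Local Notation s := (loc g / loc h).

(** This is the map pi, with target the whole fraction field; it kills g, so it retracts along
    orbits onto the slice g = 0. *)
Definition slice_proj (a : A) : {fraction A} := subst_slice g h (beta a).

Fact slice_proj_is_zmod_morphism : zmod_morphism slice_proj.
Proof.
by move=> a b; rewrite /slice_proj /subst_slice !rmorphB hornerD hornerN.
Qed.

Fact slice_proj_is_monoid_morphism : monoid_morphism slice_proj.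
Proof.
split=> [|a b]; rewrite /slice_proj /subst_slice.
  by rewrite !rmorph1 hornerC.
by rewrite !rmorphM hornerM.
Qed.

HB.instance Definition _ :=
  GRing.isZmodMorphism.Build A {fraction A} slice_proj
    slice_proj_is_zmod_morphism.
HB.instance Definition _ :=
  GRing.isMonoidMorphism.Build A {fraction A} slice_proj
    slice_proj_is_monoid_morphism.

Lemma slice_proj_invariant (a : A) : Ga_invariant beta a -> slice_proj a = loc a.
Proof. by move=> inv_a; rewrite /slice_proj /subst_slice inv_a map_polyC hornerC. Qed.

(** Scalars are invariant, so the ring morphism pi fixes them and only moves the z_i. *)
Lemma slice_proj_mmap (n : nat) (z : 'I_n -> A) (P : {mpoly k[n]}) :
  slice_proj (mmap (@in_k_alg k A) z P) =
  frac_eval (fun i => subst_slice g h (beta (z i))) P.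
Proof.
apply: rmorph_mmap => c; apply: slice_proj_invariant.
exact: coaction_scalar.
Qed.

(** As h is invariant and nonzero, the factor h^m cancels from the invariance equation, and
    injectivity of [tofrac] brings it back to A[t]. *)
Lemma loc_Ga_invariantP (x : {fraction A}) :
  loc_Ga_invariant beta h x <->
  exists (a : A) (m : nat), Ga_invariant beta a /\ x = loc a / loc h ^+ m.
Proof.
have u0 j : loc h ^+ j != 0 by rewrite expf_neq0 // tofrac_eq0.
split=> [[a [m [-> eq_p]]] | [a [m [inv_a ->]]]]; exists a, m.
  split=> //; apply: (map_inj_poly (@tofrac_inj A) (tofrac0 A)).
  apply: (scalerI (invr_neq0 (u0 m))).
  by rewrite -eq_p map_polyC /= mulrC -mul_polyC polyCM.
by split=> //; rewrite inv_a map_polyC /= mulrC -mul_polyC polyCM.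
Qed.

(* The right-hand side of the second equation is h^N times the image of
   v(-s) under the extension of beta to A_h, since beta s = s + 'X. *)
Lemma subst_slice_fraction (v : {poly A}) : exists (b : A) (N : nat),
  loc b = loc h ^+ N * subst_slice g h v /\
  map_poly loc (beta b) = loc h ^+ N *:
    (map_poly (map_poly loc \o beta) v).[- s%:P - 'X].
Proof.
have u0 : loc h != 0 by rewrite tofrac_eq0.
have [inv_h beta_g] := gh_pair.
(* Clear denominators in v(-g/h). The exponent [size v] exceeds the degree by one, which is harmless
   and covers v = 0. *)
exists (\sum_(i < size v) v`_i * (- g) ^+ i * h ^+ (size v - i)), (size v).
have hX (i : 'I_(size v)) :
    loc h ^+ size v = loc h ^+ (size v - i) * loc h ^+ i.
  by rewrite -exprD subnK // ltnW.
have hs : - loc g = loc h * - s by rewrite mulrN mulrCA mulfV // mulr1.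
split.
  rewrite /subst_slice /map_poly horner_poly mulr_sumr rmorph_sum.
  apply: eq_bigr => i _ /=.
  rewrite !rmorphM !rmorphXn rmorphN /= (hX i) hs exprMn.
  by rewrite [LHS]mulrC -[RHS]mulrA; congr (_ * _); rewrite mulrCA.
rewrite {2}/map_poly horner_poly scaler_sumr !rmorph_sum.
apply: eq_bigr => i _ /=.
rewrite !rmorphM !rmorphXn !rmorphN /= inv_h beta_g map_polyC /=.
rewrite rmorphD /= map_polyZ /= map_polyX map_polyC /= -mul_polyC.
(* This is beta(-g) = h (-s - t), which turns each power of -g into a power of the new evaluation
   point. *)
have -> : - ((loc g)%:P + (loc h)%:P * 'X) = (loc h)%:P * (- s%:P - 'X).
  by rewrite opprD -polyCN hs polyCM polyCN mulrBr.
rewrite exprMn -mul_polyC (hX i) !polyCM !polyC_exp.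
by rewrite [LHS]mulrC -[RHS]mulrA; congr (_ * _); rewrite mulrCA.
Qed.

Lemma slice_proj_loc_invariant (a : A) (m : nat) :
  loc_Ga_invariant beta h (slice_proj a / loc h ^+ m).
Proof.
have u0 j : loc h ^+ j != 0 by rewrite expf_neq0 // tofrac_eq0.
have [b [N [loc_b beta_b]]] := subst_slice_fraction (beta a).
apply/loc_Ga_invariantP; exists b, (N + m)%N; split; last first.
  by rewrite loc_b exprD -mulf_div mulfV // mul1r.
apply: (map_inj_poly (@tofrac_inj A) (tofrac0 A)).
rewrite beta_b map_polyC /= loc_b [RHS]polyCM [RHS]mul_polyC; congr (_ *: _).
(* By co-associativity the outer variable occurs only through its sum with the inner one; at -s - 'X
   that sum is -s. *)
rewrite map_poly_comp (coaction_coassoc betaP) map_comp_poly /=.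
rewrite rmorphD /= map_polyX map_polyC /= map_polyX.
rewrite -map_poly_comp (eq_map_poly (g := polyC \o loc)); last first.
  by move=> c /=; rewrite map_polyC.
rewrite map_poly_comp horner_comp hornerD hornerC hornerX addrCA subrr addr0.
by rewrite -polyCN horner_map.
Qed.

End Slice.

Theorem proposition5p2 (k : closedFieldType) (A : idomAlgType k)
    (beta : {rmorphism A -> {poly A}}) (beta_coaction : Ga_coaction beta)
    (n : nat) (z : 'I_n -> A) (z_gen : alg_generators z)
    (g h : A) (gh_pair : principle_pair beta g h) (h_neq0 : h != 0) :
  let f := fun i : 'I_n => subst_slice g h (beta (z i)) in
  (forall x : {fraction A},
     loc_subalg f h x <-> loc_Ga_invariant beta h x)
  /\
  (forall (P H : {mpoly k[n]}) (m : nat),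
     mmap (@in_k_alg k A) z H = h ->
     let r := fun y : 'I_n -> {fraction A} =>
       frac_eval y P / frac_eval y H ^+ m in
     let Z := fun i : 'I_n => tofrac (z i) in
     loc_Ga_invariant beta h (r Z) -> r Z = r f).
Proof.
move=> f.
have projE P : slice_proj beta g h (mmap (@in_k_alg k A) z P) = frac_eval f P.
  exact: slice_proj_mmap.
have proj_h := slice_proj_invariant g h gh_pair.1.
have u0 j : tofrac h ^+ j != 0 by rewrite expf_neq0 // tofrac_eq0.
split=> [x|P H m HE r Z].
  split=> [[P [m ->]]|/(loc_Ga_invariantP _ h_neq0)[a [m [inv_a ->]]]].
    by rewrite -projE; apply: slice_proj_loc_invariant.
  (* The numerator a = P(z) is invariant, so a = pi a = P(f). *)
  have [P aE] := z_gen a; exists P, m.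
  by rewrite -projE -aE slice_proj_invariant.
have ZE Q : frac_eval Z Q = tofrac (mmap (@in_k_alg k A) z Q).
  by rewrite (rmorph_mmap (d := fun c => tofrac (in_k_alg A c))).
rewrite /r !ZE -!projE HE proj_h.
(* Invariance is given for the numerator b of another expression b / h^l of r(Z), not for P(z)
   itself. So cross-multiply in A and apply pi, which fixes b and h. *)
move=> /(loc_Ga_invariantP _ h_neq0)[b [l [inv_b rE]]]; rewrite rE.
set a := mmap _ _ P in rE *.
have ab : a * h ^+ l = b * h ^+ m.
  apply: (@tofrac_inj A); rewrite !rmorphM !rmorphXn /=.
  by move/eqP: rE; rewrite eqr_div // => /eqP.
have := congr1 (slice_proj beta g h) ab.
rewrite !rmorphM !rmorphXn /= proj_h (slice_proj_invariant g h inv_b) => pab.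
by apply/eqP; rewrite eqr_div // -pab.
Qed.
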